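(* Let $(X,(f_n)_{n\in\omega})$ be an acyclic situation. Then $A_1\leq^r_c A^f$.
   Context: $(X,(f_n))$ is an acyclic situation if: (a) $X$ is a nonempty zero-dimensional perfect Polish space, each $f_n$ is a partial homeomorphism of $X$ with clopen domain and clopen range, and $\Delta(X)\subseteq\overline{A^f}\setminus A^f$, where $A^f:=\bigcup_n\mathrm{Gr}(f_n)$; (b) for every $v\in\omega^{<\omega}\setminus\{\emptyset\}$ and $\varepsilon\in\{-1,1\}^{|v|}$ such that for all $i<|v|-1$, $v(i)\neq v(i+1)$ or $\varepsilon(i)\neq-\varepsilon(i+1)$, and for every nonempty clopen $U\subseteq X$, there is a nonempty clopen $V\subseteq U$ such that for every $x\in V$, $f_{v(|v|-1)}^{\varepsilon(|v|-1)}\circ\cdots\circ f_{v(0)}^{\varepsilon(0)}(x)$ is not defined or is not in $V$. Let $\psi:\omega\to 2^{<\omega}$ be the bijection enumerating finite binary sequences by increasing length and, within each length, lexicographically; put $s_n:=\psi(n)0^{n-|\psi(n)|}$ and $A_1:=\{(s_n0\gamma,s_n1\gamma): n\in\omega,\ \gamma\in 2^\omega\}$. $A_1\leq^r_c A^f$ means there are continuous $u,v:2^\omega\to X$ with $A_1=(u\times v)^{-1}(A^f)$. *)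

(* Defs.v *)
From mathcomp Require Import all_boot all_order all_algebra.
From mathcomp Require Import all_classical all_reals topology cantor.

Set Implicit Arguments.
Unset Strict Implicit.
Unset Printing Implicit Defensive.

Import Order.TTheory GRing.Theory Num.Theory.

Local Open Scope classical_set_scope.
Local Open Scope ring_scope.

Definition separable (X : topologicalType) : Prop :=
  exists2 D : set X, countable D & dense D.

Definition is_distance (R : realType) (X : Type) (d : X -> X -> R) : Prop :=
  [/\ forall x y, 0 <= d x y,
      forall x y, d x y = 0 <-> x = y,
      forall x y, d x y = d y x &
      forall x y z, d x z <= d x y + d y z].

Definition completely_metrizable (R : realType) (X : topologicalType) : Prop :=
  exists d : X -> X -> R,
    [/\ is_distance d,
        forall (x : X) (A : set X),
          nbhs x A <-> exists2 e : R, 0 < e & [set y | d x y < e] `<=` A &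
        forall u : nat -> X,
          (forall e : R, 0 < e ->
             exists N : nat, forall m n : nat,
               (N <= m)%N -> (N <= n)%N -> d (u m) (u n) < e) ->
          exists l : X, u @ \oo --> l].

Definition polish (R : realType) (X : topologicalType) : Prop :=
  separable X /\ completely_metrizable R X.

(* The library's [zero_dimensional] only says that distinct points are
   separated by a clopen set, which is weaker for non-compact Polish spaces
   (complete Erdos space); here the clopen sets form a basis. *)
Definition clopen_based (X : topologicalType) : Prop := basis (@clopen X).

(* The values of [ph_fun] outside [ph_dom] and of [ph_inv] outside [ph_ran] are
   irrelevant. *)
Record partial_homeo (X : topologicalType) := PartialHomeo {
  ph_dom : set X;
  ph_ran : set X;
  ph_fun : X -> X;
  ph_inv : X -> X;
  ph_funS : forall x, ph_dom x -> ph_ran (ph_fun x);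
  ph_invS : forall y, ph_ran y -> ph_dom (ph_inv y);
  ph_funK : forall x, ph_dom x -> ph_inv (ph_fun x) = x;
  ph_invK : forall y, ph_ran y -> ph_fun (ph_inv y) = y;
  ph_fun_continuous : {within ph_dom, continuous ph_fun};
  ph_inv_continuous : {within ph_ran, continuous ph_inv} }.

Definition ph_graph (X : topologicalType) (h : partial_homeo X) : set (X * X) :=
  [set p | ph_dom h p.1 /\ p.2 = ph_fun h p.1].

(* The sign e : bool stands for the exponent (-1) ^ e: [ph_app h false] is h and
   [ph_app h true] is its inverse; [None] means undefined. *)
Definition ph_app (X : topologicalType) (h : partial_homeo X) (e : bool)
    (x : X) : option X :=
  if e then if `[< ph_ran h x >] then Some (ph_inv h x) else None
  else if `[< ph_dom h x >] then Some (ph_fun h x) else None.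

(* The letter of index 0 is applied first. *)
Definition word_app (X : topologicalType) (f : nat -> partial_homeo X)
    (v : seq nat) (eps : seq bool) (x : X) : option X :=
  foldl (fun o l => obind (ph_app (f l.1) l.2) o) (Some x) (zip v eps).

(* For signs, eps_i <> - eps_(i+1) amounts to eps_i = eps_(i+1). *)
Definition reduced_word (v : seq nat) (eps : seq bool) : Prop :=
  forall i, (i.+1 < size v)%N ->
    nth 0%N v i <> nth 0%N v i.+1 \/ nth false eps i = nth false eps i.+1.

Definition union_graph (X : topologicalType) (f : nat -> partial_homeo X) :
    set (X * X) :=
  \bigcup_n ph_graph (f n).

Record acyclic_situation (R : realType) (X : topologicalType)
    (f : nat -> partial_homeo X) : Prop := AcyclicSituation {
  acyclic_nonempty : [set: X] !=set0;
  acyclic_zero_dimensional : clopen_based X;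
  acyclic_perfect : perfect_set [set: X];
  acyclic_polish : polish R X;
  acyclic_clopen_dom : forall n, clopen (ph_dom (f n));
  acyclic_clopen_ran : forall n, clopen (ph_ran (f n));
  acyclic_diagonal :
    [set p : X * X | p.1 = p.2] `<=` closure (union_graph f) `\` union_graph f;
  acyclic_words : forall (v : seq nat) (eps : seq bool),
    v <> [::] -> size eps = size v -> reduced_word v eps ->
    forall U : set X, clopen U -> U !=set0 ->
    exists V : set X,
      [/\ clopen V, V !=set0, V `<=` U &
          forall x, V x ->
            word_app f v eps x = None \/
            exists2 y, word_app f v eps x = Some y & ~ V y] }.

(* The binary words of length k, in lexicographic order. *)
Fixpoint bwords (k : nat) : seq (seq bool) :=
  if k is k'.+1 then
    [seq false :: s | s <- bwords k'] ++ [seq true :: s | s <- bwords k']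
  else [:: [::]].

Definition bwords_below (m : nat) : seq (seq bool) :=
  flatten [seq bwords k | k <- iota 0 m].

(* The words of length at most n are more than n in number, so the default value
   of [nth] is never used; see [psi_bij] and [psi_shortlex]. *)
Definition psi (n : nat) : seq bool := nth [::] (bwords_below n.+1) n.

Definition s_ (n : nat) : seq bool := psi n ++ nseq (n - size (psi n)) false.

(* Concatenation of a finite and an infinite sequence: the default value of
   [nth] is used beyond the end of s. *)
Definition cat_cantor (s : seq bool) (g : cantor_space) : cantor_space :=
  fun i => nth (g (i - size s)%N) s i.

Definition A1 : set (cantor_space * cantor_space) :=
  [set p | exists (n : nat) (g : cantor_space),
     p = (cat_cantor (rcons (s_ n) false) g, cat_cantor (rcons (s_ n) true) g)].

Definition rect_cont_reducible (X Y X' Y' : topologicalType)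
    (A : set (X * Y)) (B : set (X' * Y')) : Prop :=
  exists (u : X -> X') (v : Y -> Y'),
    [/\ continuous u, continuous v & A = (fun p => (u p.1, v p.2)) @^-1` B].

Fixpoint lex (s t : seq bool) : bool :=
  match s, t with
  | a :: s', b :: t' => (~~ a && b) || (a == b) && lex s' t'
  | _, _ => false
  end.

Definition shortlex (s t : seq bool) : bool :=
  (size s < size t)%N || (size s == size t) && lex s t.

Lemma mem_bwords k s : (s \in bwords k) = (size s == k).
Proof.
have injc b : injective (cons b : seq bool -> _) by move=> ? ? [].
elim: k s => [|k IHk] [|b s] //=.
  by rewrite mem_cat; apply/negbTE/norP; split; apply/mapP => -[].
by rewrite mem_cat eqSS -IHk; case: b; rewrite (mem_map (@injc _));
  case: (s \in _) => //=; rewrite ?orbT ?orbF //; apply/negbTE/mapP => -[].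
Qed.

Lemma bwords_lex k : pairwise lex (bwords k).
Proof.
elim: k => [|k IHk] //=.
have lexc b : pairwise (relpre (cons b) lex) (bwords k).
  by apply: sub_pairwise IHk => s t /= ->; rewrite eqxx orbT.
rewrite pairwise_cat !pairwise_map !lexc !andbT.
by apply/allrelP => _ _ /mapP[s _ ->] /mapP[t _ ->].
Qed.

Lemma size_bwords k : size (bwords k) = (2 ^ k)%N.
Proof. by elim: k => //= k IH; rewrite size_cat !size_map IH expnS mul2n addnn. Qed.

Lemma bwords_belowS m : bwords_below m.+1 = bwords_below m ++ bwords m.
Proof.
by rewrite /bwords_below -addn1 iotaD map_cat flatten_cat /= cats0.
Qed.

Lemma bwords_below_prefix m k :
  exists r, bwords_below (m + k) = bwords_below m ++ r.
Proof.
elim: k => [|k [r IH]]; first by exists [::]; rewrite addn0 cats0.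
by exists (r ++ bwords (m + k)); rewrite addnS bwords_belowS IH catA.
Qed.

Lemma size_bwords_below m : (m <= size (bwords_below m))%N.
Proof.
elim: m => // m IH; rewrite bwords_belowS size_cat size_bwords -addn1.
by rewrite leq_add // expn_gt0.
Qed.

Lemma mem_bwords_below m s : (s \in bwords_below m) = (size s < m)%N.
Proof.
elim: m => // m IH; rewrite bwords_belowS mem_cat IH mem_bwords ltnS.
by rewrite [RHS]leq_eqVlt orbC.
Qed.

Lemma psi_nth n m : (n < m)%N -> psi n = nth [::] (bwords_below m) n.
Proof.
move=> nm; have [r] := bwords_below_prefix n.+1 (m - n.+1).
by rewrite subnKC // => ->; rewrite nth_cat size_bwords_below.
Qed.

Lemma bwords_below_shortlex m : pairwise shortlex (bwords_below m).
Proof.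
elim: m => // m IH; rewrite bwords_belowS pairwise_cat IH /=; apply/andP; split.
  apply/allrelP => s t; rewrite mem_bwords_below mem_bwords => sm /eqP tm.
  by rewrite /shortlex tm sm.
have := bwords_lex m; have := allss (bwords m).
apply: sub_in_pairwise => s t.
rewrite !mem_bwords => /eqP sm /eqP tm st.
by rewrite /shortlex sm tm eqxx st orbT.
Qed.

Lemma psi_shortlex m n : (m < n)%N -> shortlex (psi m) (psi n).
Proof.
move=> mn; rewrite (psi_nth (ltn_trans mn (ltnSn n))) /psi.
have /(pairwiseP [::]) := bwords_below_shortlex n.+1; apply => //.
  by apply: leq_trans (size_bwords_below _); apply: ltn_trans (ltnSn n).
by apply: leq_trans (size_bwords_below _).
Qed.

Lemma shortlexxx s : shortlex s s = false.
Proof.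
by rewrite /shortlex ltnn eqxx /=; elim: s => //= b s ->; case: b.
Qed.

Lemma psi_bij : bijective psi.
Proof.
have psi_inj : injective psi.
  move=> m n mn; case: (ltngtP m n) => // /psi_shortlex.
    by rewrite mn shortlexxx.
  by rewrite mn shortlexxx.
have psi_surj s : exists n, psi n = s.
  have sin : s \in bwords_below (size s).+1 by rewrite mem_bwords_below.
  exists (index s (bwords_below (size s).+1)).
  set i := index _ _; pose M := maxn i.+1 (size s).+1.
  rewrite (@psi_nth i M) ?leq_maxl //.
  have [r] := bwords_below_prefix (size s).+1 (M - (size s).+1).
  rewrite subnKC ?leq_maxr // => ->.
  by rewrite nth_cat index_mem sin nth_index.
pose g s := projT1 (cid (psi_surj s)).
have gK : cancel g psi by move=> s; exact: (projT2 (cid (psi_surj s))).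
by exists g => // n; apply: psi_inj; rewrite gK.
Qed.

Lemma size_psi n : (size (psi n) <= n)%N.
Proof.
by rewrite -ltnS -mem_bwords_below mem_nth // size_bwords_below.
Qed.

Lemma size_s_ n : size (s_ n) = n.
Proof. by rewrite size_cat size_nseq subnKC // size_psi. Qed.

(* Main.v *)
(** On the words of length [l], the edges [s_n0t -- s_n1t] with [n < l] form a
tree.  One builds nonempty clopen sets [U_s], decreasing in [s] and with
vanishing diameters, and letters [phi(n)] such that [f_(phi(n))] maps
[U_(s_n0t)] onto [U_(s_n1t)].  To pass to the next level, the tree is doubled
and one edge is added at [s_l]: the diagonal lies in the closure of the graphs,
so some [f_m] with a new [m] moves a point of [U_(s_l)] inside [U_(s_l)].
Condition (b) then allows one to shrink the sets so that, for the finitely many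
[m] considered at this level, the graph of [f_m] meets [U_s * U_t] only if the
path from [s] to [t] is the single letter [f_m].  The map [u] sending [a] to the
point of the intersection of the [U_(a|l)] is thus a reduction of [A_1] on both
coordinates. *)

Require Import Defs.
From mathcomp Require Import all_boot all_order all_algebra.
From mathcomp Require Import all_classical all_reals topology cantor.

Set Implicit Arguments.
Unset Strict Implicit.
Unset Printing Implicit Defensive.

Import Order.TTheory GRing.Theory Num.Theory.

Local Open Scope classical_set_scope.

(** * Paths in the tree of a given level *)

(* A vertex of the tree of level [n] is represented by any infinite sequence
   extending it, up to [agree n]. *)
Definition agree (n : nat) (a b : cantor_space) : Prop :=
  forall i, i < n -> a i = b i.

Definition vertex (n : nat) : cantor_space := nth false (s_ n).

(* The letter of the edge [s_n0t -- s_n1t] is the entry of [phi] at position [n]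
   from the end, so that passing to the next level is a [cons].  The added edge
   disconnects the two copies of the previous tree, hence must be crossed exactly
   when the last bits differ. *)
Fixpoint tree_path (phi : seq nat) (a b : cantor_space) : seq (nat * bool) :=
  if phi is m :: psi then
    let n := size psi in
    if a n == b n then tree_path psi a b
    else tree_path psi a (vertex n) ++ (m, a n) :: tree_path psi (vertex n) b
  else [::].

Lemma agreeC n a b : agree n a b -> agree n b a.
Proof. by move=> ab i /ab. Qed.

Lemma agreeW m n a b : m <= n -> agree n a b -> agree m a b.
Proof. by move=> mn ab i im; apply: ab; exact: leq_trans mn. Qed.

Lemma agreeS n a b : agree n.+1 a b <-> agree n a b /\ a n = b n.
Proof.
split=> [ab|[ab nab] i]; first by split; [exact: agreeW ab|exact: ab].
by rewrite ltnS leq_eqVlt => /predU1P[->//|/ab].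
Qed.

Lemma tree_path_eq phi a a' b b' :
  agree (size phi) a a' -> agree (size phi) b b' ->
  tree_path phi a b = tree_path phi a' b'.
Proof.
elim: phi a a' b b' => //= m phi IH a a' b b' /agreeS[aa' ->] /agreeS[bb' ->].
by rewrite (IH a a' b b') // (IH a a' _ (vertex (size phi))) //
  (IH (vertex (size phi)) (vertex (size phi)) b b').
Qed.

Lemma tree_path_nil phi a b : tree_path phi a b = [::] <-> agree (size phi) a b.
Proof.
elim: phi => //= m phi IH; rewrite agreeS; case: eqP => ab.
  by rewrite IH; split=> [|[]].
by split=> [|[]]; first by case: (tree_path phi a _).
Qed.

Lemma tree_path_letters phi a b l : l \in tree_path phi a b -> l.1 \in phi.
Proof.
elim: phi a b => //= m phi IH a b; rewrite inE; case: ifP => _.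
  by move=> /IH ->; rewrite orbT.
rewrite mem_cat inE => /or3P[/IH ->|/eqP ->|/IH ->]; rewrite ?orbT //=.
by rewrite eqxx.
Qed.

(** Fails exactly for a letter followed by its inverse: the words sorted for this relation are the
    reduced ones. *)
Definition compatible_letters (k l : nat * bool) : bool :=
  (k.1 != l.1) || (k.2 == l.2).

(** The new letter [m] occurs at most once, between two paths whose letters lie in [phi], and [m] is
    not in [phi]. *)
Lemma tree_path_sorted phi a b :
  uniq phi -> sorted compatible_letters (tree_path phi a b).
Proof.
elim: phi a b => //= m phi IH a b /andP[mphi uphi]; case: ifP => _.
  exact: IH.
have far c d l : l \in tree_path phi c d -> l.1 != m.
  by move=> /tree_path_letters; apply: contraTneq => ->.
rewrite sorted_cat_cons; apply/andP; split.
  move: (IH a (vertex (size phi)) uphi) (far a (vertex (size phi))).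
  case: (tree_path _ _ _) => //= k p pk kp.
  rewrite rcons_path pk /=; apply/orP; left; apply: kp; exact: mem_last.
move: (IH (vertex (size phi)) b uphi) (far (vertex (size phi)) b).
case: (tree_path _ _ _) => //= k p -> kp; rewrite andbT /compatible_letters.
by rewrite eq_sym kp // mem_head.
Qed.

Definition edge (n : nat) (a b : cantor_space) : Prop :=
  [/\ agree n a (vertex n), agree n b (vertex n), a n = false & b n = true].

(** The recursion descends through equal bits to the last position [n] where [a] and [b] differ.
    There the two side paths must be empty, which forces [a] and [b] to extend [vertex n]; the sign
    gives the orientation. *)
Lemma tree_path_edgeP phi a b m : tree_path phi a b = [:: (m, false)] ->
  exists n, [/\ n < size phi, edge n a b &
    forall i, n < i < size phi -> a i = b i].
Proof.
elim: phi => //= k phi IH; case: eqP => [ab|].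
  move=> /IH[n [nphi nab abn]]; exists n; split => //; first exact: leqW.
  move=> i /andP[ni]; rewrite ltnS leq_eqVlt => /predU1P[->//|iphi].
  by apply: abn; rewrite ni.
case ea: (tree_path phi a _) => [|? [|//]] //.
case: (tree_path phi _ b) (tree_path_nil phi (vertex (size phi)) b) => //= h ab.
case=> _ an; exists (size phi); split => //; last first.
  by move=> i /andP[ni]; rewrite ltnS leqNgt ni.
split => //; first exact/tree_path_nil.
  exact/agreeC/h.
by move: ab; rewrite an; case: (b _).
Qed.

Lemma tree_path_edge m phi a b :
  edge (size phi) a b -> tree_path (m :: phi) a b = [:: (m, false)].
Proof.
move=> [an bn a0 b1] /=; rewrite a0 b1 /=.
have /tree_path_nil -> := an.
by have /agreeC /tree_path_nil -> := bn.
Qed.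

(** [n] is the first position where [a] and [b] differ. *)
Lemma edge_uniq n n' a b : edge n a b -> edge n' a b -> n = n'.
Proof.
move=> [an bn a0 b1] [an' bn' a0' b1'].
case: (ltngtP n n') => // nn'.
  by have := an' _ nn'; rewrite -bn' // a0 b1.
by have := an _ nn'; rewrite -bn // a0' b1'.
Qed.

Lemma A1P a b :
  A1 (a, b) <-> exists n, edge n a b /\ forall i, n < i -> a i = b i.
Proof.
have catE e n g i : cat_cantor (rcons (s_ n) e) g i =
    if i < n then vertex n i else if i == n then e else g (i - n.+1).
  rewrite /cat_cantor nth_rcons size_s_ size_rcons size_s_ /vertex.
  by case: (ltngtP i n) => // ni; apply: set_nth_default; rewrite size_s_.
split=> [[n [g [-> ->]]]|[n [[an bn a0 b1] ab]]].
  exists n; split=> [|i ni]; last by rewrite !catE ltnNge ltnW //= gtn_eqF.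
  by split; [move=> i ni|move=> i ni| |]; rewrite catE ?ni // ltnn eqxx.
exists n, (fun i => a (i + n.+1)); congr pair; apply/funext => i; rewrite catE.
  case: (ltngtP i n) => [ni|ni|->//]; [exact: an|by rewrite subnK].
case: (ltngtP i n) => [ni|ni|->//]; [exact: bn|by rewrite subnK ?ab].
Qed.

(** * Action of words by partial homeomorphisms *)

Fixpoint act (X : topologicalType) (f : nat -> partial_homeo X)
    (w : seq (nat * bool)) (x : X) : option X :=
  if w is l :: w' then obind (act f w') (ph_app (f l.1) l.2 x) else Some x.

Lemma word_appE (X : topologicalType) (f : nat -> partial_homeo X) w x :
  word_app f (unzip1 w) (unzip2 w) x = act f w x.
Proof.
rewrite /word_app zip_unzip.
have foldN v :
    foldl (fun o l => obind (ph_app (f l.1) l.2) o) (None : option X) v = None.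
  by elim: v.
by elim: w x => //= l w IH x; case: ph_app => [y|] /=; rewrite ?IH ?foldN.
Qed.

Lemma act_cat (X : topologicalType) (f : nat -> partial_homeo X) u w x :
  act f (u ++ w) x = obind (act f w) (act f u x).
Proof. by elim: u x => //= l u IH x; case: ph_app => //= y; rewrite IH. Qed.

Lemma act_rcons (X : topologicalType) (f : nat -> partial_homeo X) w l x :
  act f (rcons w l) x = obind (ph_app (f l.1) l.2) (act f w x).
Proof.
by rewrite -cats1 act_cat; case: (act f w x) => //= y; case: ph_app.
Qed.

Lemma ph_appV (X : topologicalType) (h : partial_homeo X) e x y :
  ph_app h e x = Some y -> ph_app h (~~ e) y = Some x.
Proof.
case: e => /=; case: asboolP => // xh [<-].
  by rewrite asboolT ?ph_invK //; exact: ph_invS.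
by rewrite asboolT ?ph_funK //; exact: ph_funS.
Qed.

Lemma ph_app_graph (X : topologicalType) (h : partial_homeo X) x y :
  ph_graph h (x, y) <-> ph_app h false x = Some y.
Proof.
rewrite /ph_graph /=; split=> [[xh ->]|]; first by rewrite asboolT.
by case: asboolP => // xh [<-].
Qed.

(** The two paths concatenate to the direct one up to cancellation of inverse letters. In the main
    case the new edge is crossed back and forth. *)
Lemma act_tree_path_comp (X : topologicalType) (f : nat -> partial_homeo X)
    phi a b c x y z :
  act f (tree_path phi a b) x = Some y -> act f (tree_path phi b c) y = Some z ->
  act f (tree_path phi a c) x = Some z.
Proof.
elim: phi a b c x y z => [|m phi IH] a b c x y z /=; first by move=> [->].
set v := vertex _; set n := size phi.
have obindP (g : X -> option X) o t :
    obind g o = Some t -> exists2 s, o = Some s & g s = Some t.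
  by case: o => // s; exists s.
case: (eqVneq (a n) (b n)) => [->|ab].
  case: (eqVneq (b n) (c n)) => [bc|bc]; first exact: IH.
  rewrite !act_cat => xy /obindP[t yt tz].
  by rewrite (IH _ _ _ _ _ _ xy yt).
rewrite act_cat => /obindP[s xs] /= /obindP[t st ty].
case: (eqVneq (b n) (c n)) => [<-|bc].
  move=> yz; rewrite (negbTE ab) act_cat xs /= st /=; exact: IH ty yz.
have -> : a n == c n by case: (a n) (b n) (c n) ab bc => [] [] [].
rewrite act_cat => /obindP[r yr] /= /obindP[q rq qz].
(* The loop from [v] through [b] back to [v] acts as the empty path, so the two crossings of the new
   edge cancel. *)
have tr : t = r.
  by have := IH _ _ _ _ _ _ ty yr; rewrite (tree_path_nil _ _ _).2 // => -[].
have sq : s = q.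
  have := ph_appV st; rewrite tr; have -> : ~~ a n = b n.
    by case: (a n) (b n) ab => [] [].
  by rewrite rq => -[].
by apply: IH xs _; rewrite sq.
Qed.

(** * Cylinders and clopen preimages *)

Lemma nbhs_agree n (a : cantor_space) : nbhs a (agree n a).
Proof.
elim: n => [|n IH]; first by apply: filterS filterT => b _ i.
have an : nbhs a [set b : cantor_space | b n = a n].
  exact: (@proj_continuous nat (fun=> bool) n a _ (discrete_set1 (a n))).
by near=> b; apply/agreeS; split; [near: b|apply/esym; near: b].
Unshelve. all: by end_near. Qed.

Lemma bwords_agree n (a : cantor_space) :
  exists2 s, s \in bwords n & agree n a (nth false s).
Proof.
exists (mkseq a n); first by rewrite mem_bwords size_mkseq.
by move=> i ni; rewrite nth_mkseq.
Qed.

Lemma clopen_setI_preimage (X Y : topologicalType) (A : set X) (g : X -> Y) D :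
  clopen A -> {within A, continuous g} -> clopen D -> clopen (A `&` g @^-1` D).
Proof.
move=> [oA cA] cg [oD cD]; split.
  by rewrite open_setSI //; move/continuousP: cg; exact.
by rewrite closed_setSI //; move/continuous_closedP: cg; exact.
Qed.

Definition act_preimage (X : topologicalType) (f : nat -> partial_homeo X)
    (w : seq (nat * bool)) (D : set X) : set X :=
  [set x | exists2 y, act f w x = Some y & D y].

Lemma clopen_act_preimage (X : topologicalType) (f : nat -> partial_homeo X)
    w D :
  (forall n, clopen (ph_dom (f n))) -> (forall n, clopen (ph_ran (f n))) ->
  clopen D -> clopen (act_preimage f w D).
Proof.
move=> fdom fran; elim: w D => [|[n e] w IH] D cD.
  rewrite (_ : act_preimage _ _ _ = D) //; apply/seteqP; split => x /=.
    by move=> [_ [<-]].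
  by exists x.
have {IH cD} := IH _ cD; set E := act_preimage f w D => cE.
rewrite (_ : act_preimage _ _ _ = if e then ph_ran (f n) `&` ph_inv (f n) @^-1` E
  else ph_dom (f n) `&` ph_fun (f n) @^-1` E).
  case: e; apply: clopen_setI_preimage => //.
    exact: ph_inv_continuous.
  exact: ph_fun_continuous.
apply/seteqP; split => x; rewrite /act_preimage /=.
  by case: e => -[y] /=; case: asboolP => //= fx xy Dy; split=> //; exists y.
by case: e => -[fx [y xy Dy]] /=; rewrite asboolT //; exists y.
Qed.

(** * Coherent families of clopen sets *)

Definition shrinks (X : Type) (U' U : cantor_space -> set X) : Prop :=
  forall a, U' a `<=` U a.

(** Only inclusions are required, but for both directions of each path; by [coherent_actK], the path
    from [a] to [b] then maps [U a] onto [U b]. *)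
Record coherent (X : topologicalType) (f : nat -> partial_homeo X)
    (phi : seq nat) (U : cantor_space -> set X) : Prop := Coherent {
  coherent_clopen : forall a, clopen (U a);
  coherent_nonempty : forall a, U a !=set0;
  coherent_agree : forall a b, agree (size phi) a b -> U a = U b;
  coherent_act : forall a b, U a `<=` act_preimage f (tree_path phi a b) (U b) }.

Lemma coherent_actK (X : topologicalType) (f : nat -> partial_homeo X)
    phi U a b x y :
  coherent f phi U -> U a x -> act f (tree_path phi a b) x = Some y ->
  act f (tree_path phi b a) y = Some x.
Proof.
move=> cU Ux xy; have [y' xy' /(coherent_act cU a)[x' yx _]] :=
  coherent_act cU b Ux.
move: yx; rewrite -(Some_inj (etrans (esym xy) xy')) => yx; rewrite yx.
have := act_tree_path_comp xy yx.
by rewrite (tree_path_nil _ _ _).2 //= => -[->].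
Qed.

(** The restriction at [a] is propagated along the tree: the set at [b] keeps the points that the
    path from [b] to [a] carries into [V]. *)
Lemma coherent_restrict (R : realType) (X : topologicalType)
    (f : nat -> partial_homeo X) phi U a V :
  acyclic_situation R f -> coherent f phi U ->
  clopen V -> V !=set0 -> V `<=` U a ->
  exists U', [/\ coherent f phi U', shrinks U' U & U' a `<=` V].
Proof.
move=> acf cU cV [x0 Vx0] VU.
exists (fun b => U b `&` act_preimage f (tree_path phi b a) V); split.
- split=> [b|b|b c bc|b c x [Ux [z xz Vz]]].
  + apply: clopenI; first exact: coherent_clopen cU _.
    apply: clopen_act_preimage => //; first exact: acyclic_clopen_dom acf.
    exact: acyclic_clopen_ran acf.
  + have [y xy Uy] := coherent_act cU b (VU _ Vx0).
    by exists y; split=> //; exists x0 => //; exact: coherent_actK (VU _ Vx0) xy.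
  + by rewrite (coherent_agree cU bc) (tree_path_eq bc (b' := a)).
  + have [y xy Uy] := coherent_act cU c Ux; exists y => //; split=> //.
    by exists z => //; exact: act_tree_path_comp (coherent_actK cU Ux xy) xz.
- by move=> b x [].
- move=> x [_ [y]].
  by rewrite (tree_path_nil _ _ _).2 //= => -[<-].
Qed.

(** Finitely many requirements are met one after the other, since further shrinking does not spoil
    the earlier ones. *)
Lemma coherent_refine_all (X : topologicalType) (f : nat -> partial_homeo X)
    (phi : seq nat) (T : eqType) (r : seq T)
    (Q : T -> (cantor_space -> set X) -> Prop) U :
  (forall i U U', shrinks U' U -> Q i U -> Q i U') ->
  (forall i U, i \in r -> coherent f phi U ->
     exists U', [/\ coherent f phi U', shrinks U' U & Q i U']) ->
  coherent f phi U ->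
  exists U', [/\ coherent f phi U', shrinks U' U & forall i, i \in r -> Q i U'].
Proof.
move=> Qanti; elim: r U => [|i r IH] U Qdense cU; first by exists U; split=> // a.
have [U1 [cU1 U1U QU1]] := Qdense i U (mem_head _ _) cU.
have [|U2 [cU2 U2U1 QU2]] := IH U1 _ cU1.
  by move=> j V jr; apply: Qdense; rewrite inE jr orbT.
exists U2; split=> // [a x /U2U1/U1U//|j].
by rewrite inE => /predU1P[->|/QU2//]; exact: Qanti U2U1 QU1.
Qed.

(** * Avoiding unwanted edges and shrinking diameters *)

Lemma acyclic_avoid (R : realType) (X : topologicalType)
    (f : nat -> partial_homeo X) (w : seq (nat * bool)) U :
  acyclic_situation R f -> w <> [::] -> sorted compatible_letters w ->
  clopen U -> U !=set0 ->
  exists V, [/\ clopen V, V !=set0, V `<=` U &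
    forall x y, V x -> act f w x = Some y -> ~ V y].
Proof.
move=> acf w0 sw cU U0.
have [||//|V [cV V0 VU Vw]] :=
    @acyclic_words _ _ _ acf (unzip1 w) (unzip2 w) _ _ _ U cU U0.
- by case: w w0 {sw}.
- by rewrite !size_map.
- move=> i; rewrite size_map => iw.
  have /(sortedP (0, false))/(_ i iw) := sw.
  rewrite !(nth_map (0, false)) ?(ltnW iw) //.
  by move=> /orP[/eqP|/eqP]; [left|right].
exists V; split=> // x y Vx wxy.
have [] := Vw x Vx; rewrite word_appE wxy //.
by move=> [_ [<-]].
Qed.

(* A pair of [Gr(f_m)] between the sets at [a] and [b] turns the path from [a]
   to [b] followed by [f_m^-1] into a word returning to the set at [a]; after
   cancelling its two last letters if needed, this word is reduced, and it is
   empty only if the path consists of the letter [f_m]. *)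
Lemma coherent_avoid_graph (R : realType) (X : topologicalType)
    (f : nat -> partial_homeo X) phi U a b m :
  acyclic_situation R f -> uniq phi -> coherent f phi U ->
  tree_path phi a b <> [:: (m, false)] ->
  exists U', [/\ coherent f phi U', shrinks U' U &
    forall x y, U' a x -> U' b y -> ~ ph_graph (f m) (x, y)].
Proof.
move=> acf uphi cU pm; set p := tree_path phi a b in pm *.
have sp : sorted compatible_letters p := tree_path_sorted a b uphi.
have [w [w0 sw wE]] : exists w, [/\ w <> [::], sorted compatible_letters w &
    forall x y z, act f p x = Some y -> ph_graph (f m) (z, y) ->
      act f w x = Some z].
  have addE x y z : act f p x = Some y -> ph_graph (f m) (z, y) ->
      act f (rcons p (m, true)) x = Some z.
    by move=> xy /ph_app_graph/ph_appV zy; rewrite act_rcons xy.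
  case/lastP pE: {-}p => [|q [k e]].
    exists [:: (m, true)]; split=> // x y z.
    by rewrite -[[:: _]]/(rcons [::] _) -pE; exact: addE.
  have [/eqP km|km] := boolP ((k, e) == (m, false)).
    exists q; split.
    - by move=> q0; apply: pm; rewrite pE q0 km.
    - by move: sp; rewrite pE -cats1 => /cat_sorted2[].
    - move=> x y z; rewrite pE km act_rcons; case: (act f q x) => // t ty.
      have {ty} /ph_appV ty : ph_app (f m) false t = Some y by [].
      by move=> /ph_app_graph/ph_appV; rewrite ty => -[->].
  exists (rcons p (m, true)); split => //; first by case: (p).
  have -> : sorted compatible_letters (rcons p (m, true)) =
    sorted compatible_letters p && compatible_letters (k, e) (m, true).
    rewrite pE; case: (q) => [|l q'] /=; first by rewrite andbT.
    by rewrite [LHS]rcons_path last_rcons.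
  rewrite sp /compatible_letters /=; move: km; rewrite xpair_eqE negb_and.
  by case: (e).
have [V [cV V0 VU Vw]] := acyclic_avoid acf w0 sw (coherent_clopen cU a)
  (coherent_nonempty cU a).
have [U' [cU' U'U U'V]] := coherent_restrict acf cU cV V0 VU.
exists U'; split=> // z y U'z U'y zy.
have [x yx U'x] := coherent_act cU' a U'y.
have xy := coherent_actK cU' U'y yx.
exact: (Vw x z (U'V _ U'x) (wE _ _ _ xy zy) (U'V _ U'z)).
Qed.

(** The bound [m < size phi] brings every index under control from some level on; the case
    [m \in phi] makes the next letter new. *)
Definition tight (X : topologicalType) (f : nat -> partial_homeo X)
    (phi : seq nat) (U : cantor_space -> set X) : Prop :=
  forall a b m x y, (m < size phi) || (m \in phi) ->
    U a x -> U b y -> ph_graph (f m) (x, y) ->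
    tree_path phi a b = [:: (m, false)].

Definition diam_lt (R : realType) (X : Type) (d : X -> X -> R) (e : R)
    (A : set X) : Prop :=
  forall x y, A x -> A y -> (d x y < e)%R.

Lemma clopen_diam_lt (R : realType) (X : topologicalType) (d : X -> X -> R) e U :
  is_distance d ->
  (forall (x : X) (A : set X),
     nbhs x A <-> exists2 e : R, (0 < e)%R & [set y | d x y < e]%R `<=` A) ->
  clopen_based X -> (0 < e)%R -> clopen U -> U !=set0 ->
  exists V, [/\ clopen V, V !=set0, V `<=` U & diam_lt d e V].
Proof.
move=> [_ _ dC dD] dnbhs [_ Xbase] e0 [oU _] [x Ux].
have e20 : (0 < e / 2)%R by rewrite divr_gt0.
have xU : nbhs x ([set y | d x y < e / 2]%R `&` U).
  apply: filterI; first by apply/dnbhs; exists (e / 2)%R.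
  exact: open_nbhs_nbhs.
have [V [cV Vx] VU] := Xbase x _ xU.
exists V; split=> //; first by exists x.
  by move=> y /VU[].
move=> y z /VU[/= xy _] /VU[/= xz _].
rewrite (splitr e); apply: le_lt_trans (dD y x z) _.
by rewrite ltrD // dC.
Qed.

(** All diameters are handled first, then tightness for the finitely many triples of two vertices
    and an index; words of length [n] represent all vertices. *)
Lemma coherent_refine (R : realType) (X : topologicalType) (d : X -> X -> R)
    (f : nat -> partial_homeo X) phi U e :
  is_distance d ->
  (forall (x : X) (A : set X),
     nbhs x A <-> exists2 e : R, (0 < e)%R & [set y | d x y < e]%R `<=` A) ->
  acyclic_situation R f -> uniq phi -> coherent f phi U -> (0 < e)%R ->
  exists U', [/\ coherent f phi U', shrinks U' U, tight f phi U' &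
    forall a, diam_lt d e (U' a)].
Proof.
move=> dd dnbhs acf uphi cU e0; set n := size phi.
pose word s : cantor_space := nth false s.
have [|s V _ cV|U1 [cU1 U1U U1e]] :=
    @coherent_refine_all X f phi _ (bwords n)
      (fun s V => diam_lt d e (V (word s))) U _ _ cU.
- by move=> s V V' V'V Ve x y /V'V Vx /V'V Vy; exact: Ve.
- have [W [cW W0 WV We]] := clopen_diam_lt dd dnbhs
    (acyclic_zero_dimensional acf) e0 (coherent_clopen cV (word s))
    (coherent_nonempty cV (word s)).
  have [V' [cV' V'V V'W]] := coherent_restrict acf cV cW W0 WV.
  by exists V'; split=> // x y /V'W Wx /V'W Wy; exact: We.
pose triples := [seq (p, m) | p <- [seq (s, t) | s <- bwords n, t <- bwords n],
                              m <- iota 0 n ++ phi].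
have [|[[s t] m] V _ cV|U2 [cU2 U2U1 U2t]] :=
    @coherent_refine_all X f phi _ triples
      (fun i V => forall x y, V (word i.1.1) x -> V (word i.1.2) y ->
         ph_graph (f i.2) (x, y) ->
         tree_path phi (word i.1.1) (word i.1.2) = [:: (i.2, false)])
      U1 _ _ cU1.
- by move=> i V V' V'V Vt x y /V'V Vx /V'V Vy; exact: Vt.
- have [st|/eqP st] :=
    eqVneq (tree_path phi (word s) (word t)) [:: (m, false)].
    by exists V; split=> // a.
  have [V' [cV' V'V V'm]] := coherent_avoid_graph acf uphi cV st.
  by exists V'; split=> // x y V'x V'y /(V'm _ _ V'x V'y).
exists U2; split=> // [a x /U2U1/U1U//|a b m x y mphi|a x y].
  have [s sn sa] := bwords_agree n a; have [t tn tb] := bwords_agree n b.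
  rewrite (coherent_agree cU2 sa) (coherent_agree cU2 tb) (tree_path_eq sa tb).
  apply: (U2t (s, t, m)); apply: allpairs_f; first exact: allpairs_f.
  by rewrite mem_cat mem_iota.
have [s sn sa] := bwords_agree n a.
by rewrite (coherent_agree cU2 sa) => /U2U1 Ux /U2U1 Uy; exact: U1e sn _ _ Ux Uy.
Qed.

(** * Passing to the next level *)

(* Since the diagonal lies in the closure of the union of the graphs, some
   [f_m] moves a point of [U (vertex l)] inside this set, and tightness
   ensures that [m] is a new letter.  The two endpoints of this move are the
   germs of the sets at the two copies of [vertex l] of the next level. *)
Lemma coherent_extend (R : realType) (X : topologicalType)
    (f : nat -> partial_homeo X) phi U :
  acyclic_situation R f -> coherent f phi U -> tight f phi U ->
  exists m U', [/\ m \notin phi, coherent f (m :: phi) U' & shrinks U' U].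
Proof.
move=> acf cU tU; set v := vertex (size phi).
have [x0 Ux0] := coherent_nonempty cU v.
have [/(_ (U v `*` U v))] := acyclic_diagonal acf (erefl : (x0, x0).1 = (x0, x0).2).
have nUv : nbhs x0 (U v).
  by apply: open_nbhs_nbhs; split=> //; exact: (coherent_clopen cU v).1.
move=> /(_ (ex_intro2 _ _ (U v, U v) (conj nUv nUv) (@subset_refl _ _))).
move=> [[y z] [[m _ yz] [/= Uy Uz]]] _.
have mphi : m \notin phi.
  apply/negP => mphi; have := tU v v m y z _ Uy Uz yz.
  by rewrite mphi orbT (tree_path_nil _ _ _).2 // => /(_ isT).
have act1 e x : act f [:: (m, e)] x = ph_app (f m) e x.
  by rewrite -[[:: _]]/(rcons [::] _) act_rcons.
(* [W false] and [W true] are the germs at the two copies of [v]; by [WN], [f m] and its inverse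
   exchange them. *)
pose W e := U v `&` act_preimage f [:: (m, e)] (U v).
have WN e x x' : W e x -> ph_app (f m) e x = Some x' -> W (~~ e) x'.
  move=> [Ux [x1]]; rewrite act1 => + Ux1 xx'; rewrite xx' => -[x'1].
  split; first by rewrite x'1.
  by exists x => //; rewrite act1; exact: ph_appV.
(* The last bit selects the germ, which is transported from [v] along the old tree. *)
pose U' a := U a `&` act_preimage f (tree_path phi a v) (W (a (size phi))).
have cW e : clopen (W e).
  apply: clopenI; first exact: coherent_clopen cU _.
  apply: clopen_act_preimage; last exact: coherent_clopen cU _.
    exact: acyclic_clopen_dom acf.
  exact: acyclic_clopen_ran acf.
have W0 e : W e !=set0.
  have ap := (ph_app_graph _ _ _).1 yz.
  case: e; last by exists y; split=> //; exists z; rewrite ?act1.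
  by exists z; split=> //; exists y; rewrite ?act1 ?(ph_appV ap).
exists m, U'; split=> // [|a x []//].
split=> [a|a|a b /agreeS[ab nab]|a b x [Ux [t xt Wt]]].
- apply: clopenI; first exact: coherent_clopen cU _.
  apply: clopen_act_preimage => //; first exact: acyclic_clopen_dom acf.
  exact: acyclic_clopen_ran acf.
- have [x Wx] := W0 (a (size phi)).
  have [t xt Ut] := coherent_act cU a Wx.1.
  by exists t; split=> //; exists x => //; exact: coherent_actK Wx.1 xt.
- by rewrite /U' nab (coherent_agree cU ab) (tree_path_eq ab (b' := v)).
rewrite /act_preimage /=; case: eqP => ab.
  have [s xs Us] := coherent_act cU b Ux; exists s => //; split=> //.
  exists t; last by rewrite -ab.
  exact: act_tree_path_comp (coherent_actK cU Ux xs) xt.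
(* The path crosses the new edge: [x] goes to [t] at one copy of [v], to [r] at the other, then to
   [s]. *)
case: (Wt) => _ [r]; rewrite act1 => tr _.
have := WN _ _ _ Wt tr.
have -> : ~~ a (size phi) = b (size phi) by case: (a _) (b _) ab => [] [].
move=> Wr; have [s rs Us] := coherent_act cU b Wr.1.
exists s; first by rewrite act_cat -/v xt /= tr.
by split=> //; exists r => //; exact: coherent_actK Wr.1 rs.
Qed.

(** * The limit map and the reduction *)

Lemma cantor_intersection_point (R : realType) (X : topologicalType)
    (d : X -> X -> R) (V : nat -> set X) :
  (forall u : nat -> X,
     (forall e : R, (0 < e)%R -> exists N : nat, forall m n : nat,
        N <= m -> N <= n -> (d (u m) (u n) < e)%R) ->
     exists l : X, u @ \oo --> l) ->
  (forall n, closed (V n)) -> (forall n, V n !=set0) ->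
  (forall m n, m <= n -> V n `<=` V m) ->
  (forall e : R, (0 < e)%R -> exists n, diam_lt d e (V n)) ->
  exists x, forall n, V n x.
Proof.
move=> dcomplete Vcl V0 Vanti Ve.
have /choice[u Vu] : forall n, exists x, V n x by exact: V0.
have [|l ul] := dcomplete u.
  move=> e /Ve[N VNe]; exists N => m n Nm Nn.
  by apply: VNe; [exact: Vanti Nm _ _|exact: Vanti Nn _ _].
exists l => n; apply: (closed_cvg (V n)) ul => //.
near=> k; apply: (Vanti n k) => //; near: k; exact: nbhs_infty_ge.
Unshelve. all: by end_near. Qed.

Lemma exists_invS_lt (R : realType) (e : R) :
  (0 < e)%R -> exists n, (n.+1%:R^-1 < e)%R.
Proof.
move=> e0; exists (Num.truncn e^-1).
by rewrite invf_plt ?posrE ?ltr0n // truncnS_gt.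
Qed.

Theorem theorem28 (R : realType) (X : topologicalType)
    (f : nat -> partial_homeo X) :
  acyclic_situation R f -> rect_cont_reducible A1 (union_graph f).
Proof.
move=> acf; have [_ [d [dd dnbhs dcomplete]]] := acyclic_polish acf.
(* The length of [p.1] is the level, which also sets the diameter bound. *)
pose good (p : seq nat * (cantor_space -> set X)) :=
  [/\ uniq p.1, coherent f p.1 p.2, tight f p.1 p.2 &
    forall a, diam_lt d (size p.1).+1%:R^-1 (p.2 a)].
have [p0 [gp0 p00]] : exists p, good p /\ p.1 = [::].
  have cT : coherent f [::] (fun=> [set: X]).
    split=> // [a|a|a b x _]; [exact: clopenT|exact: acyclic_nonempty acf|].
    by exists x.
  have [//||U [cU _ tU dU]] := coherent_refine dd dnbhs acf _ cT (e := 1%:R^-1%R).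
    by rewrite invr_gt0.
  by exists ([::], U); split.
have step (p : {p | good p}) : {q : {p | good p} |
    (exists m, (sval q).1 = m :: (sval p).1) /\
    shrinks (sval q).2 (sval p).2}.
  apply: cid; case: p => -[phi U] [uphi cU tU dU].
  have [m [U1 [mphi cU1 U1U]]] := coherent_extend acf cU tU.
  have um : uniq (m :: phi) by rewrite /= mphi.
  have [|U2 [cU2 U2U1 tU2 dU2]] := coherent_refine dd dnbhs acf um cU1
    (e := (size (m :: phi)).+1%:R^-1%R); first by rewrite invr_gt0 ltr0n.
  have g : good (m :: phi, U2) by split.
  exists (exist _ _ g); split; first by exists m.
  by move=> a x /U2U1/U1U.
have [st [st0 stS]] := dependent_choice step (exist _ p0 gp0).
pose phi l := (sval (st l)).1; pose U l := (sval (st l)).2.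
have sphi l : size (phi l) = l.
  elim: l => [|l IH]; first by rewrite /phi st0 p00.
  by rewrite /phi; have [[m ->] _] := stS l; rewrite /= IH.
have cU l : coherent f (phi l) (U l) by have [] := svalP (st l).
have tU l : tight f (phi l) (U l) by have [] := svalP (st l).
have dU l a : diam_lt d l.+1%:R^-1 (U l a).
  by have [_ _ _ /(_ a)] := svalP (st l); rewrite -/(phi l) sphi.
have Uanti a k l : k <= l -> U l a `<=` U k a.
  move=> /subnK <-; elim: (l - k) => [|i IH] //= x Ux.
  by apply: IH; have [_ /(_ a)] := stS (i + k); apply.
have Ueq x y : (forall l, (d x y < l.+1%:R^-1)%R) -> x = y.
  have [d0 dE _ _] := dd; move=> xy; apply/dE; apply/eqP.
  rewrite eq_le d0 andbT leNgt; apply/negP => /exists_invS_lt[l].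
  by rewrite ltNge (ltW (xy l)).
have /choice[u Uu] : forall a, exists x, forall l, U l a x.
  move=> a; apply: (cantor_intersection_point dcomplete).
  - by move=> l; exact: (coherent_clopen (cU l) a).2.
  - by move=> l; exact: coherent_nonempty (cU l) a.
  - exact: Uanti.
  - move=> e /exists_invS_lt[l le]; exists l => x y Ux Uy.
    exact: lt_trans (dU l a _ _ Ux Uy) le.
have cu : continuous u.
  move=> a A /dnbhs[e /exists_invS_lt[l le] eA].
  apply: filterS (nbhs_agree l a) => b ab; apply: eA => /=.
  apply: lt_trans le; apply: dU (Uu a l) _.
  by rewrite (coherent_agree (cU l) (b := b)) ?sphi.
exists u, u; split=> //; apply/seteqP; split=> -[a b] /=.
  move=> /A1P[n [nab abn]].
  have [m mn] : exists m, phi n.+1 = m :: phi n by have [] := stS n.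
  (* Beyond position [n] the bits of [a] and [b] agree, so the path created at level [n.+1] no
     longer changes. *)
  have ml l : n < l -> tree_path (phi l) a b = [:: (m, false)].
    elim: l => // l IH; rewrite ltnS leq_eqVlt => /predU1P[<-|nl].
      by rewrite mn; apply: tree_path_edge; rewrite sphi.
    have [[k kl] _] := stS l; rewrite /phi kl /= -/(phi l) sphi abn // eqxx.
    exact: IH.
  (* The image of [u a] under [f m] lies in the sets at [b] of all levels above [n], as [u b] does;
     vanishing diameters identify the two points. *)
  have [y [ay Uy]] : exists y, ph_app (f m) false (u a) = Some y /\
      forall l, n < l -> U l b y.
    have yl l : n < l -> exists2 y, ph_app (f m) false (u a) = Some y & U l b y.
      move=> nl; have [y] := coherent_act (cU l) b (Uu a l); rewrite ml //.
      by rewrite -[[:: _]]/(rcons [::] _) act_rcons; exists y.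
    have [y ay _] := yl n.+1 (ltnSn n); exists y; split=> // l /yl[z].
    by rewrite ay => -[->].
  exists m => //; apply/ph_app_graph; rewrite ay; congr Some; apply: Ueq => l.
  apply: (dU l b) (Uu b l).
  apply: (Uanti b l (maxn l n.+1)); first exact: leq_maxl.
  by apply: Uy; exact: leq_maxr.
move=> [m _ abm].
(* Tightness applies to [f m] as soon as the level exceeds [m]. *)
have ml l : m < l -> tree_path (phi l) a b = [:: (m, false)].
  by move=> ml; apply: (tU l) (Uu a l) (Uu b l) abm; rewrite sphi ml.
have [n [nm nab _]] := tree_path_edgeP (ml m.+1 (ltnSn m)).
apply/A1P; exists n; split=> // i ni.
(* For each [i], a level above both [m] and [i] is used; by [edge_uniq], the edge found there is the
   same. *)
have [|k [_ kab]] := tree_path_edgeP (ml (maxn m i).+1 _).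
  by rewrite ltnS leq_maxl.
by rewrite (edge_uniq kab nab); apply; rewrite ni sphi ltnS leq_maxr.
Qed.
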